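(* Let $d\ge2$ and consider an elliptic i.i.d. random environment on $\mathbb{Z}^d$. If the environment verifies condition $(E')_1$, then it also verifies condition $(K)_1$.
   Context: Setting. $U$ is the set of the $2d$ canonical unit vectors of $\mathbb{Z}^d$, and $\mathcal{P}=\{(p(e))_{e\in U}: p(e)\ge 0,\ \sum_{e\in U}p(e)=1\}$. An environment is $\omega\in\Omega=\mathcal{P}^{\mathbb{Z}^d}$, i.e. a family $p^\omega(x,\cdot)=(p^\omega(x,e))_{e\in U}$, $x\in\mathbb{Z}^d$. The quenched law $P^\omega_x$ is the law of the Markov chain $(X_n)_{n\ge0}$ on $\mathbb{Z}^d$ with $P_x^\omega[X_0=x]=1$ and $P_x^\omega[X_{n+1}=y+e\mid X_n=y]=p^\omega(y,e)$. The environment has law $\mathbf{P}$ (expectation $\mathbf{E}$), under which the $p^\omega(x,\cdot)$, $x\in\mathbb{Z}^d$, are i.i.d. The environment is elliptic if $\mathbf{P}$-a.s. $p^\omega(x,e)>0$ for all $x\in\mathbb{Z}^d$, $e\in U$. Fix a unit vector $\ell\in S^{d-1}$ and enumerate $U$ so that $e_1,\dots,e_d$ is an orthonormal basis with $e_1\cdot\ell\ge\dots\ge e_d\cdot\ell\ge0$, and $e_{i+d}=-e_i$ for $1\le i\le d$. Notation. $x\sim y$ iff $\|x-y\|_1=1$; $\partial V=\{x\notin V:\exists y\in V,\ x\sim y\}$; $\partial_xA=\{y\in\partial A: x\sim y\}$ for $x\in A$; $T_A=\inf\{n\ge0:X_n\in A\}$; $T_x^+=\inf\{n\ge1:X_n=x\}$.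 Condition $(E')_1$: there exists $\{\phi(e):e\in U\}\in(0,\infty)^{2d}$ such that (1) $2\sum_{e\in U}\phi(e)-\sup_{e\in U}(\phi(e)+\phi(-e))>1$; and (2) for every $e\in U$, $\mathbf{E}\bigl[\exp\bigl(\sum_{e'\ne e}\phi(e')\log\frac1{p^\omega(0,e')}\bigr)\bigr]<\infty$. Hypercubes. $\mathfrak{H}_x=\{x+\sum_{i=1}^d\epsilon_ie_i:\epsilon_i\in\{0,1\}\}$, $\mathfrak{H}=\mathfrak{H}_0$; these are the unit hypercubes of $\mathbb{Z}^d$. $\overline{\mathfrak{H}}_0$ is the set of unit hypercubes containing $0$. For a unit hypercube $\mathcal{C}$ and $x,y\in\mathcal{C}$, set $$Q_y^{\mathcal{C}}=\max_{z\in\partial_y\mathcal{C}}p^\omega(y,z-y),\qquad \widetilde Q_{x,y}^{\mathcal{C}}=P_x^\omega\bigl[T_{\partial\mathcal{C}}<T_x^+,\ X_{T_{\partial\mathcal{C}}}\in\partial_y\mathcal{C}\bigr].$$ Marked Markovian hypercube. A hypercube discovered in a Markovian fashion is a map $h:\Omega\to\overline{\mathfrak{H}}_0$ of the form $h(\omega)=\{f_0(\omega),\dots,f_{2^d-1}(\omega)\}$, with $f_i:\Omega\to\mathbb{Z}^d$ such that: $f_0=0$; each $f_{i+1}$ is measurable with respect to $\{p^\omega(x,\cdot):x\in\{f_0(\omega),\dots,f_i(\omega)\}\}$ (i.e. $f_{i+1}$ is determined measurably by the already discovered sites and the transition probabilities at these sites); $f_{i+1}(\omega)\in\partial\{f_0(\omega),\dots,f_i(\omega)\}$;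 and for each $i$, $\mathbf{P}$-a.s. there is $H(\omega)\in\overline{\mathfrak{H}}_0$ with $\{f_0(\omega),\dots,f_i(\omega)\}\subset H(\omega)$. Let $x_0(\omega)$ be the unique point with $h(\omega)=\{x_0(\omega)+y:y\in\mathfrak{H}\}$. A marked Markovian hypercube is a couple $(h(\omega),(\alpha_x(\omega))_{x\in\mathfrak{H}})$ with $h$ a hypercube discovered in a Markovian fashion and each $\alpha_x:\Omega\to\mathbb{R}^+=[0,\infty)$ measurable with respect to $\{p^\omega(y,\cdot):y\in h(\omega)\}$ (i.e. determined measurably by $h(\omega)$ and the transition probabilities at the sites of $h(\omega)$). Condition $(K)_1$: (1) there exist $\gamma_x\in\mathbb{R}^+$, $x\in\mathfrak{H}$, with $\mathbf{E}[(Q_x^{\mathfrak{H}})^{-\gamma_x}]<\infty$ for all $x\in\mathfrak{H}$; (2) there exists a marked Markovian hypercube $(h(\omega),(\alpha_x(\omega))_{x\in\mathfrak{H}})$ with $\mathbf{E}\bigl[\prod_{x\in\mathfrak{H}}(\widetilde Q_{0,x_0(\omega)+x}^{h(\omega)})^{-\alpha_x(\omega)}\bigr]<\infty$; (3) there exists $\epsilon>0$ such that $\sum_{x\in\mathfrak{H}}(\gamma_x\wedge\alpha_x(\omega))\ge1+\epsilon$, $\mathbf{P}$-a.s. *)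

(* Defs.v *)
From HB Require Import structures.
From mathcomp Require Import all_boot all_order all_algebra.
From mathcomp Require Import all_classical all_reals all_analysis.
From mathcomp Require Import measurable_realfun lra.

Set Implicit Arguments.
Unset Strict Implicit.
Unset Printing Implicit Defensive.
Import Order.TTheory GRing.Theory Num.Theory.
Local Open Scope classical_set_scope.
Local Open Scope ring_scope.

(* Throughout, the dimension is d = n.+1: a measurableType is inhabited, and
   the simplex of jump probabilities is empty in dimension 0.               *)

Notation lattice n := 'rV[int]_n.+1.

HB.instance Definition _ := isPointed.Build int 0.

(* Elements of U, encoded as (axis, is the sign negative?). *)
Notation dir n := ('I_n.+1 * bool)%type.

Definition uvec n (u : dir n) : lattice n := (-1) ^+ u.2 *: delta_mx 0 u.1.

Definition dopp n (u : dir n) : dir n := (u.1, ~~ u.2).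

Definition dotp (K : pzRingType) n (u v : 'rV[K]_n.+1) : K :=
  \sum_i u 0 i * v 0 i.

(* The vectors e_1, ..., e_d attached to ell (i : 'I_n.+1 starts at 0);
   e_(i+d) is dopp (e i).                                                   *)
Definition adapted_basis (R : realType) n (ell : 'rV[R]_n.+1)
    (e : 'I_n.+1 -> dir n) : Prop :=
  [/\ forall i j, dotp (uvec (e i)) (uvec (e j)) = (i == j)%:R,
      forall i j : 'I_n.+1, (i <= j)%N ->
        dotp (map_mx intr (uvec (e j))) ell <=
        dotp (map_mx intr (uvec (e i))) ell
    & forall i, 0 <= dotp (map_mx intr (uvec (e i))) ell].

Definition adj n (x y : lattice n) : Prop := \sum_i `|(x - y) 0 i| = 1.

Definition bdry n (V : set (lattice n)) : set (lattice n) :=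
  [set x | ~ V x /\ exists2 y, V y & adj x y].

(* $\partial_x A$ *)
Definition bdry_at n (A : set (lattice n)) (x : lattice n) :
  set (lattice n) := [set y | bdry A y /\ adj x y].

Record jump_prob (R : realType) n := JumpProb {
  jump :> {ffun dir n -> R} ;
  jumpP : [forall u, 0 <= jump u] && (\sum_u jump u == 1) }.

Section jump_prob_instances.
Variables (R : realType) (n : nat).

HB.instance Definition _ := [isSub for @jump R n].
HB.instance Definition _ := [Choice of jump_prob R n by <:].

Lemma dirac_jumpP :
  let p := [ffun u : dir n => (u == (ord0, false))%:R : R] in
  [forall u, 0 <= p u] && (\sum_u p u == 1).
Proof.
apply/andP; split; first by apply/forallP => u; rewrite ffunE ler0n.
rewrite (bigD1 (ord0, false)) //= ffunE eqxx big1 ?addr0 // => u /negbTE hu.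
by rewrite ffunE hu.
Qed.

HB.instance Definition _ :=
  isPointed.Build (jump_prob R n) (JumpProb dirac_jumpP).

End jump_prob_instances.

Definition simplex (R : realType) n := g_sigma_algebraType
  [set A : set (jump_prob R n) | exists u, exists2 B : set R,
     measurable B & A = [set p : jump_prob R n | B (p u)]].

(* $\Omega$ with its product sigma-algebra *)
Definition env (R : realType) n := g_sigma_algebraType
  [set A : set (lattice n -> simplex R n) |
     exists x, exists2 B : set (simplex R n),
       measurable B & A = [set w : lattice n -> simplex R n | B (w x)]].

Definition iid_env (R : realType) n (P : probability (env R n) R) : Prop :=
  (forall x (B : set (simplex R n)), measurable B ->
     P [set w : env R n | B (w x)] = P [set w : env R n | B (w 0)]) /\
  (forall (s : seq (lattice n)) (B : lattice n -> set (simplex R n)),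
     uniq s -> (forall x, measurable (B x)) ->
     P [set w : env R n | forall x, x \in s -> B x (w x)] =
     (\prod_(x <- s) P [set w : env R n | B x (w x)])%E).

Definition elliptic (R : realType) n (P : probability (env R n) R) : Prop :=
  {ae P, forall w : env R n, forall x u, 0 < w x u}.

Definition paths n := g_sigma_algebraType
  [set A : set (nat -> lattice n) |
     exists k y, A = [set X : nat -> lattice n | X k = y]].

Definition is_quenched_law (R : realType) n (w : env R n) (x : lattice n)
    (Px : probability (paths n) R) : Prop :=
  Px [set X : paths n | X 0%N = x] = 1%E /\
  forall k (y : nat -> lattice n) (u : dir n),
    Px [set X : paths n | (forall i, (i <= k)%N -> X i = y i) /\
                          X k.+1 = y k + uvec u] =
    (Px [set X : paths n | forall i, (i <= k)%N -> X i = y i]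
      * (w (y k) u)%:E)%E.

(* Existence of the quenched laws: a uniform point of [0, 1[ selects the first
   jump through its position among consecutive slots of lengths w x u, and its
   rescaled position in the slot drives the following jumps.                *)
Section quenched_law_exists.
Variables (R : realType) (n : nat) (w : env R n).
Implicit Types (x : lattice n) (u v : dir n) (r : seq (dir n)) (t : R).

Let w_ge0 x u : 0 <= w x u.
Proof. by have /andP[/forallP + _] := jumpP (w x); apply. Qed.

Let w_sum x : \sum_u w x u = 1.
Proof. by have /andP[_ /eqP] := jumpP (w x). Qed.

Fixpoint slot_of x r t : dir n :=
  if r is u :: r' then
    if t < w x u then u else slot_of x r' (t - w x u)
  else (ord0, false).

Fixpoint slot_start x r u : R :=
  if r is v :: r' then
    if v == u then 0 else w x v + slot_start x r' u
  else 0.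

Lemma slot_start_ge0 x r u : 0 <= slot_start x r u.
Proof.
by elim: r => //= v r ih; case: ifP => // _; rewrite addr_ge0.
Qed.

Lemma slot_end_le x r u : u \in r ->
  slot_start x r u + w x u <= \sum_(v <- r) w x v.
Proof.
elim: r => //= v r ih; rewrite inE big_cons eq_sym.
case: eqP => [->|_] /=; last by move=> /ih h; rewrite -addrA lerD2l.
by move=> _; rewrite add0r lerDl sumr_ge0.
Qed.

Lemma slot_of_mem x r t : 0 <= t < \sum_(v <- r) w x v ->
  slot_of x r t \in r.
Proof.
elim: r t => [|v r ih] t /=.
  by rewrite big_nil => /andP[h1 h2]; have := le_lt_trans h1 h2; rewrite ltxx.
rewrite big_cons => /andP[t0 t1]; case: ltP => h; first by rewrite inE eqxx.
by rewrite inE ih ?orbT// subr_ge0 h/= ltrBlDl.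
Qed.

Lemma slot_ofE x r t u : uniq r -> u \in r ->
  0 <= t < \sum_(v <- r) w x v ->
  (slot_of x r t == u) = (slot_start x r u <= t < slot_start x r u + w x u).
Proof.
elim: r t => //= v r ih t /andP[vr ur]; rewrite inE big_cons => uvr.
move=> /andP[t0 t1]; have [vu|vu] := eqVneq v u.
  subst u; rewrite t0 add0r /=; case: ltP => h; first by rewrite eqxx.
  apply/negbTE; apply: contra vr => /eqP <-.
  by apply: slot_of_mem; rewrite subr_ge0 h/= ltrBlDl.
have {}uvr : u \in r by move: uvr; rewrite eq_sym (negbTE vu).
case: ltP => h.
  rewrite (negbTE vu); apply/esym/negbTE; rewrite negb_and -ltNge.
  by rewrite (lt_le_trans h)// lerDl slot_start_ge0.
rewrite ih//; last by rewrite subr_ge0 h/= ltrBlDl.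
by rewrite lerBrDl ltrBlDl addrA.
Qed.

Local Notation slot x := (slot_of x (index_enum (dir n))).
Local Notation start x := (slot_start x (index_enum (dir n))).

Definition walk_step (xt : lattice n * R) : lattice n * R :=
  let: (x, t) := xt in
  let u := slot x t in (x + uvec u, (t - start x u) / w x u).

Definition walk x t (k : nat) : lattice n := (iter k walk_step (x, t)).1.

Lemma walkS x t k :
  walk x t k.+1 = walk (x + uvec (slot x t))
                    ((t - start x (slot x t)) / w x (slot x t)) k.
Proof. by rewrite /walk iterSr. Qed.

Lemma slotE x t u : 0 <= t < 1 ->
  (slot x t == u) = (start x u <= t < start x u + w x u).
Proof.
move=> t01; apply: slot_ofE; first exact: index_enum_uniq.
  exact: mem_index_enum.
by rewrite w_sum.
Qed.

Lemma end_le1 x u : start x u + w x u <= 1.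
Proof. by rewrite -(w_sum x); exact/slot_end_le/mem_index_enum. Qed.

Lemma uvec_inj : injective (@uvec n).
Proof.
move=> [i b] [j c] /matrixP h; have := h 0 i; have := h 0 j.
rewrite /uvec !mxE !eqxx /=; case: (eqVneq i j) => [->|ij].
  by case: b {h}; case: c => //; rewrite eqxx.
by rewrite ?(eq_sym j i) ?(negbTE ij) /=; case: c {h}; case: b.
Qed.

Fixpoint path_weight (k : nat) x (y : nat -> lattice n) : R :=
  (y 0%N == x)%:R *
  (if k is k'.+1 then
     \sum_(u | y 1%N == x + uvec u)
       w x u * path_weight k' (x + uvec u) (fun i => y i.+1)
   else 1).

Lemma path_weight_last k x y :
  path_weight k.+1 x y =
  path_weight k x y * \sum_(u | y k.+1 == y k + uvec u) w (y k) u.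
Proof.
elim: k x y => [|k ih] x y; rewrite [LHS]/=.
  rewrite /=; case: eqVneq => [<-|_]; last by rewrite !mul0r.
  rewrite !mul1r; apply: eq_bigr => u /eqP <-.
  by rewrite eqxx !mulr1.
rewrite [in RHS]/= -mulrA; congr (_ * _); rewrite mulr_suml.
by apply: eq_bigr => u _; rewrite -mulrA -ih.
Qed.

Lemma walk_cylinder k x (y : nat -> lattice n) :
  exists a, [/\ 0 <= a, 0 <= path_weight k x y, a + path_weight k x y <= 1 &
    forall t, 0 <= t < 1 ->
      (forall i, (i <= k)%N -> walk x t i = y i) <->
      a <= t < a + path_weight k x y].
Proof.
have bad a t : ~ a <= t < a + 0 by rewrite addr0; lra.
elim: k x y => [|k ih] x y.
  rewrite /= mulr1; exists 0; split; rewrite ?add0r ?ler0n ?lern1 ?leq_b1 //.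
  move=> t /andP[t0 t1]; case: eqP => [yx|yx].
    rewrite t0 t1; split=> // _ [|i]// _; by rewrite yx.
  split; first by move=> /(_ 0%N erefl) h; case: yx; rewrite -h.
  by move=> h; case: (bad 0 t); rewrite add0r.
rewrite /=; case: eqP => [yx|yx]; last first.
  rewrite mul0r; exists 0; split; rewrite ?addr0// => t _; split.
    by move=> /(_ 0%N erefl) h; case: yx; rewrite -h.
  by move=> h; case: (bad 0 t); rewrite addr0.
rewrite mul1r; have [u yu|nou] := pickP (fun u => y 1%N == x + uvec u);
    last first.
  rewrite big_pred0 //; exists 0; split; rewrite ?addr0// => t _; split.
    by move=> /(_ 1%N erefl) h; have := nou (slot x t); rewrite -h eqxx.
  by move=> h; case: (bad 0 t); rewrite addr0.
rewrite (big_pred1 u); last first.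
  move=> v; rewrite (eqP yu) (inj_eq (addrI x)) (inj_eq uvec_inj).
  by rewrite eq_sym.
have [a [a0 L0 aL h]] := ih (x + uvec u) (fun i => y i.+1).
set L := path_weight _ _ _ in L0 aL h *.
set p : R := w x u; set s := start x u.
have p0 : 0 <= p := w_ge0 x u.
have s0 : 0 <= s := slot_start_ge0 x _ u.
have sp : s + p <= 1 := end_le1 x u.
exists (s + p * a); split.
- by rewrite addr_ge0// mulr_ge0.
- by rewrite mulr_ge0.
- by rewrite -addrA -mulrDr (le_trans _ sp)// lerD2l ler_piMr.
move=> t t01.
have -> : (forall i, (i <= k.+1)%N -> walk x t i = y i) <->
    slot x t = u /\ (forall i, (i <= k)%N ->
       walk (x + uvec u) ((t - s) / p) i = y i.+1).
  split=> [H|[H1 H2] [|i] ik]; last 2 first.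
  - by rewrite yx.
  - by rewrite walkS H1 H2.
  have su : slot x t = u.
    apply/eqP; rewrite -(inj_eq uvec_inj) -(inj_eq (addrI x)) -(eqP yu).
    by rewrite -(H 1%N).
  by split=> // i ik; rewrite -(H i.+1)// walkS su.
have := slotE x u t01; rewrite -/s -/p => sE.
have [pz|pnz] := eqVneq p 0.
  split=> [[/eqP + _]|]; rewrite ?sE pz ?mul0r !addr0 => /andP[h1 h2];
    by have := le_lt_trans h1 h2; rewrite ltxx.
have pp : 0 < p by rewrite lt_neqAle eq_sym pnz.
split.
- move=> [/eqP]; rewrite sE => /andP[st tsp].
  have t'01 : 0 <= (t - s) / p < 1.
    by rewrite ler_pdivlMr // ltr_pdivrMr // mul0r mul1r; lra.
  move=> /(h _ t'01); rewrite ler_pdivlMr// ltr_pdivrMr//.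
  by rewrite mulrDl ![_ * p]mulrC; lra.
- move=> H.
  have pa : 0 <= p * a by rewrite mulr_ge0.
  have paL : p * a + p * L <= p by rewrite -mulrDr ler_piMr.
  have st : s <= t < s + p by lra.
  have t'01 : 0 <= (t - s) / p < 1.
    by rewrite ler_pdivlMr // ltr_pdivrMr // mul0r mul1r; lra.
  split; first by apply/eqP; rewrite sE.
  apply/(h _ t'01); rewrite ler_pdivlMr// ltr_pdivrMr//.
  by rewrite mulrDl ![_ * p]mulrC; lra.
Qed.

Lemma measurable_walk k x z :
  measurable ([set t : R | walk x t k = z] `&` `[0, 1[).
Proof.
elim: k x => [|k ih] x.
  have [->|xz] := eqVneq x z.
    by rewrite (_ : [set _ | _] = setT) ?setTI//; apply/seteqP; split.
  rewrite (_ : [set _ | _] = set0) ?set0I//.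
  by apply/seteqP; split=> // t /eqP; rewrite /walk /= (negbTE xz).
rewrite (_ : _ `&` _ = \big[setU/set0]_(u : dir n)
  (`[start x u, start x u + w x u[ `&`
   (fun t => (t - start x u) / w x u) @^-1`
     ([set t | walk (x + uvec u) t k = z] `&` `[0, 1[))).
  apply: bigsetU_measurable => u _; apply: measurableI => //.
  rewrite -[X in measurable X]setTI.
  have mf : measurable_fun [set: R] (fun t => (t - start x u) / w x u).
    by apply: measurable_funM => //; exact: measurable_funB.
  exact: mf.
rewrite -bigcup_seq/=; apply/seteqP; split => t /=.
- move=> [tz]; rewrite in_itv/= => t01; exists (slot x t) => /=.
    exact: mem_index_enum.
  have := slotE x (slot x t) t01; rewrite eqxx => /esym/andP[h1 h2].
  have pp : 0 < w x (slot x t) by move: h1 h2; lra.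
  split; first by rewrite in_itv /= h1 h2.
  split; first by rewrite -walkS.
  by rewrite in_itv/= ler_pdivlMr // ltr_pdivrMr // mul0r mul1r; lra.
- move=> [u _ [+ [tz _]]]; rewrite /= !in_itv/= => /andP[h1 h2].
  have s0 := slot_start_ge0 x (index_enum (dir n)) u.
  have t01 : 0 <= t < 1.
    by rewrite (le_trans s0 h1) (lt_le_trans h2 (end_le1 x u)).
  have /eqP su : slot x t == u by rewrite slotE// h1 h2.
  by split=> //; rewrite walkS su.
Qed.

Lemma measurable_fun_walk x :
  measurable_fun (`[0, 1[%classic : set R) (walk x : R -> paths n).
Proof.
apply: measurability => // _ [_ [k [z ->]] <-]; rewrite setIC.
exact: measurable_walk.
Qed.

Lemma measurable_walk_preimage x (A : set (paths n)) : measurable A ->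
  measurable (`[0, 1[%classic `&` (walk x : R -> paths n) @^-1` A).
Proof. by move=> mA; exact: measurable_fun_walk. Qed.

Definition walk_law x (A : set (paths n)) : \bar R :=
  lebesgue_measure (`[0, 1[%classic `&` (walk x : R -> paths n) @^-1` A).

Let walk_law0 x : walk_law x set0 = 0%E.
Proof. by rewrite /walk_law preimage_set0 setI0 measure0. Qed.

Let walk_law_ge0 x A : (0 <= walk_law x A)%E.
Proof. exact: measure_ge0. Qed.

Let walk_law_sigma_additive x : semi_sigma_additive (walk_law x).
Proof.
move=> F mF tF mUF; rewrite /walk_law preimage_bigcup setI_bigcupr.
apply: measure_semi_sigma_additive.
- by move=> k; exact: measurable_walk_preimage.
- apply/trivIsetP => /= i j _ _ ij; rewrite setIACA.
  rewrite -[X in _ `&` X]preimage_setI; have /trivIsetP /(_ i j Logic.I Logic.I ij) -> := tF.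
  by rewrite preimage_set0 setI0.
- by rewrite -setI_bigcupr -preimage_bigcup; exact: measurable_walk_preimage.
Qed.

HB.instance Definition _ x := isMeasure.Build _ _ _ (walk_law x)
  (walk_law0 x) (walk_law_ge0 x) (@walk_law_sigma_additive x).

Let walk_law_setT x : walk_law x [set: _] = 1%E.
Proof.
rewrite /walk_law preimage_setT setIT lebesgue_measure_itv/= lte_fin ltr01.
by rewrite oppr0 adde0.
Qed.

HB.instance Definition _ x := Measure_isProbability.Build _ _ _ (walk_law x)
  (walk_law_setT x).

Lemma walk_law_cylinder k x (y : nat -> lattice n) :
  walk_law x [set X | forall i, (i <= k)%N -> X i = y i] =
  (path_weight k x y)%:E.
Proof.
have [a [a0 L0 aL h]] := walk_cylinder k x y.
rewrite /walk_law (_ : _ `&` _ = `[a, a + path_weight k x y[%classic).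
  rewrite lebesgue_measure_itv/= lte_fin ltrDl; case: ltP => L.
    by rewrite -EFinB addrC addKr.
  by congr EFin; apply/eqP; rewrite eq_le L0 L.
apply/seteqP; split=> t /=; rewrite !in_itv/=.
  by move=> [t01 H]; apply/h.
move=> H; have t01 : 0 <= t < 1 by lra.
by split=> //; apply/h.
Qed.

Lemma walk_law_quenched x : is_quenched_law w x (walk_law x).
Proof.
split=> [|k y u].
  have := walk_law_cylinder 0 x (fun=> x); rewrite /= eqxx mulr1 => <-.
  congr (walk_law x _); apply/seteqP; split=> X /=; last exact.
  by move=> X0 [|].
pose y' i := if (i <= k)%N then y i else y k + uvec u.
have -> : [set X : paths n | (forall i, (i <= k)%N -> X i = y i) /\
    X k.+1 = y k + uvec u] =
    [set X | forall i, (i <= k.+1)%N -> X i = y' i].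
  apply/seteqP; split=> X /= => [[H1 H2] i|H].
    rewrite leq_eqVlt /y' => /predU1P[->|]; first by rewrite ltnn.
    by rewrite ltnS => ik; rewrite ik H1.
  split=> [i ik|]; first by rewrite H ?(leqW ik)// /y' ik.
  by rewrite H// /y' ltnn.
have -> : [set X : paths n | forall i, (i <= k)%N -> X i = y i] =
    [set X | forall i, (i <= k)%N -> X i = y' i].
  by apply/seteqP; split=> X /= H i ik; have := H i ik; rewrite /y' ik.
rewrite [LHS](walk_law_cylinder k.+1 x y').
rewrite [X in (X * _)%E](walk_law_cylinder k x y').
rewrite path_weight_last EFinM; congr (_ * _%:E)%E.
rewrite /y' ltnn leqnn (big_pred1 u)// => v.
by rewrite (inj_eq (addrI _)) (inj_eq uvec_inj) eq_sym.
Qed.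

Lemma quenched_law_exists x :
  exists Px : probability (paths n) R, is_quenched_law w x Px.
Proof. by exists (walk_law x); exact: walk_law_quenched. Qed.

End quenched_law_exists.

(* $P^\omega_x$: since path cylinders form a pi-system generating the
   sigma-algebra of paths n, is_quenched_law w x has a unique solution.     *)
Definition quenched_law (R : realType) n (w : env R n) (x : lattice n) :
  probability (paths n) R := projT1 (cid (quenched_law_exists w x)).

Lemma quenched_lawP (R : realType) n (w : env R n) (x : lattice n) :
  is_quenched_law w x (quenched_law w x).
Proof. exact: projT2 (cid (quenched_law_exists w x)). Qed.

(* The infimum of the empty set is +oo. *)
Definition hit (R : realType) n (A : set (lattice n)) (X : paths n) : \bar R :=
  ereal_inf [set (k%:R)%:E | k in [set k | A (X k)]].

Definition hit_succ (R : realType) n (x : lattice n) (X : paths n) : \bar R :=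
  ereal_inf [set (k%:R)%:E | k in [set k | (1 <= k)%N /\ X k = x]].

(* Condition (E')_1 *)
Definition condE' (R : realType) n (P : probability (env R n) R) : Prop :=
  exists phi : dir n -> R,
  [/\ forall u, 0 < phi u,
      1 < 2 * (\sum_u phi u) - sup (range (fun u => phi u + phi (dopp u)))
    & forall u, ('E_P[fun w : env R n =>
         expR (\sum_(u' | u' != u) phi u' * ln ((w 0 u')^-1))%R] < +oo)%E].

(* Vertices of the hypercube at 0: epsilon in {0,1}^d stands for the site
   corner e epsilon, a bijection when e is an adapted basis.                *)
Notation vertex n := {ffun 'I_n.+1 -> bool}.

Definition corner n (e : 'I_n.+1 -> dir n) (v : vertex n) : lattice n :=
  \sum_(i | v i) uvec (e i).

Definition hypercube n (e : 'I_n.+1 -> dir n) (x : lattice n) :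
  set (lattice n) := [set x + corner e v | v in [set: vertex n]].

Definition hypercubes0 n (e : 'I_n.+1 -> dir n) : set (set (lattice n)) :=
  [set C | C 0 /\ exists x, C = hypercube e x].

(* The maximum ranges over a nonempty family of nonnegative numbers when y is
   a vertex of C, so that the default value 0 is harmless.                  *)
Definition Qmax (R : realType) n (w : env R n) (C : set (lattice n))
    (y : lattice n) : R :=
  \big[Num.max/0]_(u : dir n | (y + uvec u) \in bdry_at C y) w y u.

(* $\widetilde Q_{x,y}^C$ *)
Definition Qtilde (R : realType) n (w : env R n) (C : set (lattice n))
    (x y : lattice n) : R :=
  fine (quenched_law w x [set X : paths n |
    (hit R (bdry C) X < hit_succ R x X)%E /\
    exists2 k, hit R (bdry C) X = (k%:R)%:E & bdry_at C y (X k)]).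

(* For a random set S of sites, the sigma-algebra of S and of the transition
   probabilities at the sites of S; B = setT yields the events {x in S}.    *)
Definition sigma_at (R : realType) n (S : env R n -> set (lattice n)) :
  set (set (env R n)) :=
  <<s [set A : set (env R n) | exists x, exists2 B : set (simplex R n),
         measurable B & A = [set w : env R n | S w x /\ B (w x)]] >>.

Definition discovered (R : realType) n (f : nat -> env R n -> lattice n)
    (i : nat) (w : env R n) : set (lattice n) :=
  [set f j w | j in [set j | (j <= i)%N]].

Definition markovian_hypercube (R : realType) n (e : 'I_n.+1 -> dir n)
    (P : probability (env R n) R) (h : env R n -> set (lattice n)) : Prop :=
  (forall w, hypercubes0 e (h w)) /\
  exists f : nat -> env R n -> lattice n,
  [/\ forall w, h w = discovered f (2 ^ n.+1).-1 w,
      forall w, f 0%N w = 0,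
      forall i, (i.+1 < 2 ^ n.+1)%N -> forall Y : set (lattice n),
        sigma_at (discovered f i) (f i.+1 @^-1` Y),
      forall i, (i.+1 < 2 ^ n.+1)%N -> forall w,
        bdry (discovered f i w) (f i.+1 w)
    & forall i, (i < 2 ^ n.+1)%N ->
        {ae P, forall w : env R n,
          exists2 H, hypercubes0 e H & discovered f i w `<=` H}].

Definition marked_markovian_hypercube (R : realType) n
    (e : 'I_n.+1 -> dir n) (P : probability (env R n) R)
    (h : env R n -> set (lattice n)) (alpha : vertex n -> env R n -> R) :
  Prop :=
  [/\ markovian_hypercube e P h,
      forall v w, 0 <= alpha v w
    & forall v (B : set R), measurable B -> sigma_at h (alpha v @^-1` B)].

(* Condition (K)_1; x0 w is $x_0(\omega)$, which is determined by h w. The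
   convention 0 `^ (- c) = 0 for c > 0 plays no role for an elliptic law,
   under which Qmax and Qtilde are almost surely positive here.             *)
Definition condK (R : realType) n (e : 'I_n.+1 -> dir n)
    (P : probability (env R n) R) : Prop :=
  exists (gamma : vertex n -> R) (h : env R n -> set (lattice n))
    (x0 : env R n -> lattice n) (alpha : vertex n -> env R n -> R),
  [/\ forall v, 0 <= gamma v /\
        ('E_P[fun w : env R n =>
           (Qmax w (hypercube e 0) (corner e v) `^ (- gamma v))%R] < +oo)%E,
      marked_markovian_hypercube e P h alpha,
      forall w, h w = hypercube e (x0 w),
      ('E_P[fun w : env R n =>
         (\prod_(v : vertex n)
            Qtilde w (h w) 0 (x0 w + corner e v)
              `^ (- alpha v w))%R] < +oo)%E
    & exists2 eps : R, 0 < eps &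
        {ae P, forall w : env R n,
          1 + eps <= \sum_(v : vertex n) Num.min (gamma v) (alpha v w)}].

(* Main.v *)
Require Import Defs.
From HB Require Import structures.
From mathcomp Require Import all_boot all_order all_algebra.
From mathcomp Require Import all_classical all_reals all_analysis.
From mathcomp Require Import measurable_realfun ring lra.

Set Implicit Arguments.
Unset Strict Implicit.
Unset Printing Implicit Defensive.
Import Order.TTheory GRing.Theory Num.Theory.
Local Open Scope classical_set_scope.
Local Open Scope ring_scope.

(** Write p for the jump probabilities and phi for the exponents of the moment
condition, and consider two neighbouring sites x and x + u.  The steps that
leave this pair are, from each of the two sites, those in the directions other
than u and -u, and besides -u from x and u from x + u.  Their exponents add up
to 2 * sum phi - phi(u) - phi(-u), which exceeds 1 by the moment condition.  The
proof uses this for the pair 0 and u in a hypercube, provided that the step from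
0 to u is free: each step leaving the pair is continued along a straight line
until it leaves the hypercube.

That step is made free by the choice of the hypercube.  Some direction u has
p(0,u) >= 1/(2d), and u is read off from p(0,.) alone, so a walker who looks at
the site 0 may pick a hypercube that contains 0 and u and then explore it in
any fixed connected order ([markovian_rooted_cube]).

Identify the hypercube with bool^d; v0 is the vertex at 0 and j is the axis of
u.  At a vertex v and for each axis i, exactly one of the two directions of
axis i leaves the hypercube, [outward v i]; the other one is [inward v i], so u
is [inward v0 j].  Put gamma_v = sum_i phi(outward v i).  Let alpha_v be the
same sum restricted to the axes i for which the line through v in direction i
meets the edge {0,u} (the relation [tube]).  Then alpha <= gamma, and summing
alpha over the vertices gives at least 2 * sum phi - phi(u) - phi(-u)
([sum_tube_ge]).

If [tube v i] holds, the walk leaves the hypercube at v without returning to 0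
by going to the point of {0,u} on the line (free), along that line to v, then
out ([Qtilde_ge_tube]).  Hence prod_v Qtilde_v^(-alpha_v) is at most a constant
times a product of powers p(y,u')^(-phi(u')), in which a pair (y,u') occurs at
most once: with u' outward if the path leaves the hypercube at y, with u'
inward if the path only crosses it from y.  No path uses the inward direction
of axis j with an exponent, so at each site one direction is missing
([prod_powRN_Qtilde_le]), and the factor of that site has finite expectation by
hypothesis.  Independence of the sites makes the expectation of the product
finite ([iid_expectation_prod_lty]).

The quantities [Qmax] and [Qtilde] enter only through upper bounds for
expectations of nonnegative functions; the integral of such a function is a
supremum over simple functions, so these bounds ask for no measurability of the
smaller function ([ae_le_integral_lty]). *)

(** * Integrals *)

Section integral_tools.
Local Open Scope ereal_scope.
Context d (T : measurableType d) (R : realType).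
Variable mu : {measure set T -> \bar R}.

Import HBNNSimple.

(** Only the simple functions below [f] matter, and they are below [g]. *)
Lemma ge0_le_integral_nonmeas (f g : T -> \bar R) :
  (forall x, 0 <= f x) -> (forall x, f x <= g x) ->
  \int[mu]_x f x <= \int[mu]_x g x.
Proof.
move=> f0 fg; have g0 x : 0 <= g x by exact: le_trans (fg x).
rewrite !ge0_integralTE//; apply: ge_ereal_sup => _ [h /= hf <-].
by apply: ereal_sup_ubound; exists h => //= x; exact: le_trans (fg x).
Qed.

(** Raising [g] to infinity on a null set makes the comparison hold everywhere
and leaves its integral unchanged. *)
Lemma ae_le_integral_lty (f g : T -> \bar R) :
  (forall x, 0 <= f x) -> (forall x, 0 <= g x) -> measurable_fun setT g ->
  {ae mu, forall x, f x <= g x} ->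
  \int[mu]_x g x < +oo -> \int[mu]_x f x < +oo.
Proof.
move=> f0 g0 mg [N [mN N0 Nfg]] goo.
pose g' x := if x \in N then +oo else g x.
have fg' x : f x <= g' x.
  rewrite /g'; case: ifPn => [_|xN]; first exact: leey.
  by apply: contrapT => fg; move/negP: xN; apply; rewrite inE; exact: Nfg.
have mg' : measurable_fun setT g'.
  apply: measurable_fun_ifT => //; apply: (@measurable_fun_bool _ _ _ _ true).
  rewrite setTI (_ : _ @^-1` _ = N)//.
  by apply/seteqP; split => x /= h; [exact: set_mem|exact: mem_set].
apply: le_lt_trans (ge0_le_integral_nonmeas f0 fg') _.
rewrite (@ge0_ae_eq_integral _ _ _ mu setT g' g)//.
- by move=> x _; exact: le_trans (fg' x).
- exists N; split => // x /= h; apply: contrapT => xN; apply: h => _.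
  by rewrite /g' memNset.
Qed.

End integral_tools.

(** [G] is a factor independent of [X], and [c] stands for its mean.  The
product rule is assumed against the events of [X] only, because this is what an
induction on the number of independent factors provides. *)
Section independence.
Local Open Scope ereal_scope.
Context d d' (T : measurableType d) (S : measurableType d') (R : realType).
Variables (mu : {measure set T -> \bar R}) (X : T -> S) (G : T -> R).
Hypotheses (mX : measurable_fun setT X) (mG : measurable_fun setT G).
Hypothesis G0 : forall x, (0 <= G x)%R.
Variable c : \bar R.
Hypothesis cfin : c \is a fin_num.
Hypothesis indepG : forall A : set S, measurable A ->
  \int[mu]_x (G x * \1_A (X x))%:E = c * mu (X @^-1` A).

Import HBNNSimple.

Let mindic A : measurable A -> measurable_fun setT (fun x => \1_A (X x) : R).
Proof. by move=> mA; apply: measurableT_comp mX; exact: measurable_indic. Qed.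

Lemma integral_indep_nnsfun (h : {nnsfun S >-> R}) :
  \int[mu]_x (G x * h (X x))%:E = c * \int[mu]_x (h (X x))%:E.
Proof.
have mh r : measurable (h @^-1` [set r]) by exact: measurable_sfunP.
have lhs r x : (r * (G x * \1_(h @^-1` [set r]) (X x)))%R =
    (G x * (r * \1_(h @^-1` [set r]) (X x)))%R by rewrite mulrCA.
have hE x : h (X x) = (\sum_(r \in range h) r * \1_(h @^-1` [set r]) (X x))%R.
  exact: fimfunE.
have rge0 r x : (0 <= r * \1_(h @^-1` [set r]) (X x))%R.
  by have := nnfun_muleindic_ge0 h r (X x); rewrite -EFinM lee_fin.
under [in RHS]eq_integral do rewrite hE -fsumEFin//.
rewrite ge0_integral_fsum//; last 2 first.
- by move=> r; apply/measurable_EFinP/measurable_funM => //; exact: mindic.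
- by move=> r x _; rewrite lee_fin.
rewrite ge0_mule_fsumr; last first.
  by move=> r; apply: integral_ge0 => x _; rewrite lee_fin.
under eq_integral.
  move=> x _; rewrite hE mulrC fsbig_finite//= mulr_suml -fsbig_finite//=.
  rewrite -fsumEFin//; over.
rewrite ge0_integral_fsum//; last 2 first.
- move=> r; apply/measurable_EFinP/measurable_funM => //.
  by apply/measurable_funM => //; exact: mindic.
- by move=> r x _; rewrite lee_fin mulr_ge0.
apply: eq_fsbigr => r _.
(* The values of h are nonnegative, so both sides vanish for negative r. *)
have [r0|r0] := ltP r 0%R.
  have Xr x : \1_(h @^-1` [set r]) (X x) = 0%R :> R.
    by rewrite preimage_nnfun0// indicE in_set0.
  by rewrite !integral0_eq ?mule0// => x _; rewrite Xr mulr0 ?mul0r.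
under eq_integral do rewrite mulrC -lhs EFinM.
rewrite ge0_integralZl_EFin//; last 2 first.
- by move=> x _; rewrite lee_fin mulr_ge0.
- by apply/measurable_EFinP/measurable_funM => //; exact: mindic.
rewrite indepG//.
under [in RHS]eq_integral do rewrite EFinM.
rewrite ge0_integralZl_EFin//; last by apply/measurable_EFinP; exact: mindic.
rewrite muleCA; congr (_ * (_ * _)).
have mXr : measurable (X @^-1` (h @^-1` [set r])).
  by rewrite -[X in measurable X]setTI; exact: mX.
transitivity (\int[mu]_x (\1_(X @^-1` (h @^-1` [set r])) x)%:E).
  by rewrite integral_indic// setIT.
by apply: eq_integral => x _; rewrite !indicE.
Qed.

(** Monotone convergence along simple functions increasing to [F]. *)
Lemma integral_indep (F : S -> R) :
  measurable_fun setT F -> (forall y, 0 <= F y)%R ->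
  \int[mu]_x (G x * F (X x))%:E = c * \int[mu]_x (F (X x))%:E.
Proof.
move=> mF F0.
have mF' : measurable_fun setT (EFin \o F) by exact/measurable_EFinP.
pose h := nnsfun_approx measurableT mF'.
have nd_h y : {homo h ^~ y : m k / (m <= k)%N >-> (m <= k)%R}.
  by move=> m k mk; exact/lefP/nd_nnsfun_approx.
have cvg_h y : (h k y)%:E @[k --> \oo] --> (F y)%:E.
  by apply: (@cvg_nnsfun_approx _ _ _ _ measurableT _ mF') => // z _;
    rewrite /= lee_fin.
have mhX k : measurable_fun setT (fun x => h k (X x)).
  by apply: measurableT_comp => //; exact: measurable_sfun.
have -> : \int[mu]_x (F (X x))%:E = limn (fun k => \int[mu]_x (h k (X x))%:E).
  rewrite -monotone_convergence//.
  - by apply: eq_integral => x _; apply/esym/cvg_lim => //; exact: cvg_h.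
  - by move=> k; exact/measurable_EFinP.
  - by move=> k x _; rewrite lee_fin.
  - by move=> x _ m k mk; rewrite lee_fin; exact: nd_h.
rewrite -limeMl//; last first.
  apply: ereal_nondecreasing_is_cvgn => m k mk; apply: ge0_le_integral => //.
  - by move=> x _; rewrite lee_fin.
  - by exact/measurable_EFinP.
  - by exact/measurable_EFinP.
  - by move=> x _; rewrite lee_fin; exact: nd_h.
rewrite (_ : (fun k => _) = fun k => \int[mu]_x (G x * h k (X x))%:E); last first.
  by apply/funext => k; rewrite integral_indep_nnsfun.
rewrite -monotone_convergence//.
- apply: eq_integral => x _; apply/esym/cvg_lim => //.
  under eq_fun do rewrite EFinM.
  by rewrite EFinM; apply: cvgeZl => //; exact: cvg_h.
- by move=> k; exact/measurable_EFinP/measurable_funM.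
- by move=> k x _; rewrite lee_fin mulr_ge0.
- by move=> x _ m k mk; rewrite lee_fin ler_wpM2l//; exact: nd_h.
Qed.

End independence.

(** * Independent sites *)

Section environment.
Variables (R : realType) (n : nat).

Lemma measurable_site (x : lattice n) :
  measurable_fun setT (fun w : env R n => w x).
Proof.
move=> _ B mB; rewrite setTI; apply: sub_sigma_algebra.
by exists x, B.
Qed.

Lemma measurable_jump (u : dir n) :
  measurable_fun setT (fun p : simplex R n => p u : R).
Proof.
move=> _ B mB; rewrite setTI; apply: sub_sigma_algebra.
by exists u, B.
Qed.

Lemma jump_ge0 (p : simplex R n) u : 0 <= p u.
Proof. by have /andP[/forallP h _] := jumpP p. Qed.

Lemma jump_le1 (p : simplex R n) u : p u <= 1.
Proof.
have /andP[/forallP h /eqP <-] := jumpP p.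
by rewrite (bigD1 u)//= lerDl sumr_ge0.
Qed.

Lemma measurable_sites (s : seq (lattice n)) (B : lattice n -> set (simplex R n)) :
  (forall x, measurable (B x)) ->
  measurable [set w : env R n | forall x, x \in s -> B x (w x)].
Proof.
move=> mB; rewrite (_ : mkset _ =
  \bigcap_(x in [set` s]) [set w : env R n | B x (w x)]); last first.
  by apply/seteqP; split.
apply: fin_bigcap_measurable; first exact: finite_seq.
by move=> x _; rewrite -[X in measurable X]setTI; exact: measurable_site.
Qed.

Variable P : probability (env R n) R.
Hypothesis iidP : iid_env P.

(** The sites of [s1] carry functions and those of [s2] events, so that the
induction on [s1] can turn one event at a time into a function. *)
Lemma iid_expectation_prod_indic (F : lattice n -> simplex R n -> R)
    (s1 s2 : seq (lattice n)) (B : lattice n -> set (simplex R n)) :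
  (forall x, measurable_fun setT (F x)) -> (forall x p, 0 <= F x p) ->
  (forall x, \int[P]_w (F x (w x))%:E < +oo)%E ->
  (forall x, measurable (B x)) -> uniq (s1 ++ s2) ->
  (\int[P]_w (\prod_(x <- s1) F x (w x) *
     \1_[set w : env R n | forall x, x \in s2 -> B x (w x)] w)%:E =
   (\prod_(x <- s1) \int[P]_w (F x (w x))%:E) *
   P [set w : env R n | forall x, x \in s2 -> B x (w x)])%E.
Proof.
move=> mF F0 Foo; elim: s1 s2 B => [|a s1 IH] s2 B mB us.
  rewrite big_nil mul1e.
  under eq_integral do rewrite big_nil mul1r.
  by rewrite integral_indic// ?setIT//; exact: measurable_sites.
have Ffin x : (\int[P]_w (F x (w x))%:E)%E \is a fin_num.
  rewrite ge0_fin_numE//; apply: integral_ge0 => w _.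
  by rewrite lee_fin.
pose E2 := [set w : env R n | forall x, x \in s2 -> B x (w x)].
have mE2 : measurable E2 by exact: measurable_sites.
pose G (w : env R n) := \prod_(x <- s1) F x (w x) * \1_E2 w.
have us1a : uniq (s1 ++ a :: s2) by rewrite -(cat1s a s2) uniq_catCA.
have us2 : a \notin s2 /\ uniq s2.
  by move: us1a; rewrite cat_uniq => /and3P[_ _ /=/andP[]].
transitivity (\int[P]_w (G w * F a (w a))%:E)%E.
  by apply: eq_integral => w _; rewrite big_cons /G -mulrA mulrC.
rewrite (@integral_indep _ _ _ _ _ _ (fun w : env R n => w a) G _ _ _
  ((\prod_(x <- s1) \int[P]_w (F x (w x))%:E) * P E2)%E)//.
- by rewrite big_cons muleC -muleA.
- exact: measurable_site.
- apply: measurable_funM; last exact: measurable_indic.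
  apply: measurable_prod => x _.
  by apply: measurableT_comp => //; exact: measurable_site.
- by move=> w; rewrite mulr_ge0// prodr_ge0.
- by rewrite fin_numM ?fin_num_measure// prode_fin_num.
move=> A mA; pose B' x := if x == a then A else B x.
have B'E : [set w : env R n | forall x, x \in a :: s2 -> B' x (w x)] =
    [set w | A (w a)] `&` E2.
  apply/seteqP; split => w /= h.
    split; first by have := h a (mem_head _ _); rewrite /B' eqxx.
    move=> x xs; have := h x; rewrite inE xs orbT => /(_ isT).
    by rewrite /B'; case: eqP => // xa; move: us2.1; rewrite -xa xs.
  case: h => h1 h2 x; rewrite inE /B'; case: eqVneq => [->//|_ /=].
  exact: h2.
have mB' x : measurable (B' x) by rewrite /B'; case: ifP.
have P' := IH (a :: s2) B' mB' us1a.
transitivity (\int[P]_w (\prod_(x <- s1) F x (w x) *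
     \1_[set w : env R n | forall x, x \in a :: s2 -> B' x (w x)] w)%:E)%E.
  apply: eq_integral => w _; rewrite B'E /G -mulrA; congr (_ * _)%:E.
  by rewrite indicI mulrC; congr (_ * _).
rewrite P' -muleA; congr (_ * _)%E.
rewrite iidP.2//=; last by case: us2 => -> ->.
rewrite big_cons {1}/B' eqxx muleC; congr (_ * _)%E.
rewrite /E2 (iidP.2 s2 B us2.2 mB); apply: eq_big_seq => x xs.
by rewrite /B'; case: eqP => // xa; move: us2.1; rewrite -xa xs.
Qed.

Lemma iid_expectation_prod (F : lattice n -> simplex R n -> R)
    (s : seq (lattice n)) :
  (forall x, measurable_fun setT (F x)) -> (forall x p, 0 <= F x p) ->
  (forall x, \int[P]_w (F x (w x))%:E < +oo)%E -> uniq s ->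
  (\int[P]_w (\prod_(x <- s) F x (w x))%:E =
   \prod_(x <- s) \int[P]_w (F x (w x))%:E)%E.
Proof.
move=> mF F0 Foo us.
have := @iid_expectation_prod_indic F s [::] (fun=> setT) mF F0 Foo.
rewrite cats0 (_ : [set w : env R n | _] = setT); last first.
  by apply/seteqP; split.
rewrite probability_setT mule1 => <-//.
by apply: eq_integral => w _; rewrite indicT mulr1.
Qed.

Lemma iid_expectation_site (F : simplex R n -> R) (x : lattice n) :
  measurable_fun setT F -> (forall p, 0 <= F p) ->
  (\int[P]_w (F (w x))%:E = \int[P]_w (F (w 0))%:E)%E.
Proof.
move=> mF F0.
have step y : (\int[P]_w (F (w y))%:E =
    \int[pushforward P (fun w : env R n => w y)]_p (F p)%:E)%E.
  rewrite (ge0_integral_pushforward (measurable_site y))//.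
  - exact/measurable_EFinP.
  - by move=> p _; rewrite lee_fin.
rewrite (step x) (step 0); apply: eq_measure_integral => [||mx m0 A mA _].
- exact: measurable_site.
- exact: measurable_site.
- exact: (iidP.1 x A mA).
Qed.

End environment.

(** * Paths of the quenched walk *)

Section quenched.
Variables (R : realType) (n : nat).
Implicit Types (w : env R n) (C : set (lattice n)) (x z : lattice n).

Lemma quenched_law_path w x (y : nat -> lattice n) (u : nat -> dir n) k :
  y 0%N = x -> (forall i, (i < k)%N -> y i.+1 = y i + uvec (u i)) ->
  quenched_law w x [set X : paths n | forall i, (i <= k)%N -> X i = y i] =
  (\prod_(i < k) w (y i) (u i))%:E.
Proof.
have [q0 qS] := quenched_lawP w x.
move=> y0; elim: k => [|k IH] yS.
  rewrite big_ord0 -[RHS]q0; congr (quenched_law w x _).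
  apply/seteqP; split => X /= h; first by rewrite -y0; exact: h.
  by move=> i; rewrite leqn0 => /eqP ->; rewrite y0.
rewrite big_ord_recr/= EFinM -IH; last by move=> i ik; apply: yS; exact: ltnW.
rewrite -qS; congr (quenched_law w x _); apply/seteqP; split => X /=.
  move=> h; split; first by move=> i ik; apply: h; exact: leqW.
  by rewrite -yS//; exact: h.
move=> [h1 h2] i; rewrite leq_eqVlt => /predU1P[->|/h1//].
by rewrite h2 yS.
Qed.

Definition exits_through C x z (k : nat) (X : nat -> lattice n) : Prop :=
  [/\ forall i, (i < k)%N -> ~ bdry C (X i), bdry_at C z (X k)
    & forall i, (0 < i <= k)%N -> X i <> x].

(** Comparing the two hitting times amounts to inspecting the path up to its
first visit to the boundary. *)
Lemma exit_eventE C x z :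
  [set X : paths n | (hit R (bdry C) X < hit_succ R x X)%E /\
    exists2 k, hit R (bdry C) X = (k%:R)%:E & bdry_at C z (X k)] =
  [set X : paths n | exists k, exits_through C x z k X].
Proof.
apply/seteqP; split => X /=.
  move=> [hX [k hk bk]]; exists k; split => // i.
    move=> ik bi; have : (hit R (bdry C) X <= (i%:R)%:E)%E.
      by apply: ereal_inf_lbound; exists i.
    by rewrite hk lee_fin ler_nat leqNgt ik.
  move=> /andP[i0 ik] Xi; move: hX; rewrite hk; apply/negP; rewrite -leNgt.
  apply: (@le_trans _ _ (i%:R)%:E); last by rewrite lee_fin ler_nat.
  by apply: ereal_inf_lbound; exists i.
move=> [k [h1 h2 h3]].
have hk : hit R (bdry C) X = (k%:R)%:E.
  apply/eqP; rewrite eq_le; apply/andP; split.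
    by apply: ereal_inf_lbound; exists k => //; exact: h2.1.
  apply: le_ereal_inf_tmp => _ [i /= bi <-]; rewrite lee_fin ler_nat leqNgt.
  by apply/negP => /h1.
split; last by exists k.
rewrite hk; apply: (@lt_le_trans _ _ (k.+1%:R)%:E).
  by rewrite lte_fin ltr_nat.
apply: le_ereal_inf_tmp => _ [i /= [i0 Xi] <-]; rewrite lee_fin ler_nat ltnNge.
by apply/negP => ik; apply: (h3 i) => //; rewrite i0.
Qed.

Definition cylinder (s : seq (lattice n)) : set (paths n) :=
  [set X : paths n | forall i, (i < size s)%N -> X i = s`_i].

Lemma measurable_cylinder s : measurable (cylinder s).
Proof.
rewrite (_ : cylinder s =
  \bigcap_(i in `I_(size s)) [set X : paths n | X i = s`_i]); last first.
  by apply/seteqP; split.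
apply: fin_bigcap_measurable; first exact: finite_II.
by move=> i _; apply: sub_sigma_algebra; exists i, s`_i.
Qed.

(** The event is decided by a finite initial segment of the path, hence it is
the union of the cylinders it contains, and there are countably many. *)
Lemma measurable_exit_event C x z :
  measurable [set X : paths n | exists k, exits_through C x z k X].
Proof.
pose E := [set X : paths n | exists k, exits_through C x z k X].
rewrite -/E.
rewrite (_ : E = \bigcup_(s : seq (lattice n))
   (if `[< cylinder s `<=` E >] then cylinder s else set0)); last first.
  apply/seteqP; split => X.
    move=> [k [h1 h2 h3]]; exists (mkseq X k.+1) => //.
    have cX : cylinder (mkseq X k.+1) X.
      by move=> i; rewrite size_mkseq => ik; rewrite nth_mkseq.
    case: asboolP => // -[] Y cY; exists k.
    have YX i : (i <= k)%N -> Y i = X i.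
      by move=> ik; rewrite cY ?size_mkseq// nth_mkseq.
    split.
    - by move=> i ik; rewrite YX ?(ltnW ik)//; exact: h1.
    - by rewrite YX.
    - by move=> i /andP[i0 ik]; rewrite YX//; apply: h3; rewrite i0.
  by move=> [s _]; case: asboolP => // cE cX; exact: cE.
apply: countable_bigcupT_measurable => [//|s].
by case: asboolP => // _; exact: measurable_cylinder.
Qed.

(** One admissible path already gives a lower bound: its cylinder is part of
the exit event. *)
Lemma Qtilde_ge_path w C x (y : nat -> lattice n) (u : nat -> dir n) k :
  y 0%N = x -> (forall i, (i <= k)%N -> y i.+1 = y i + uvec (u i)) ->
  (forall i, (i <= k)%N -> C (y i)) ->
  (forall i, (0 < i <= k)%N -> y i <> x) ->
  bdry_at C (y k) (y k.+1) ->
  \prod_(i < k.+1) w (y i) (u i) <= Qtilde w C x (y k).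
Proof.
move=> y0 yS yC yx yk; rewrite /Qtilde exit_eventE -lee_fin fineK; last first.
  by apply: fin_num_measure; exact: measurable_exit_event.
rewrite -(@quenched_law_path w x y u k.+1 y0 yS).
apply: le_measure; rewrite ?inE; last 2 first.
- exact: measurable_exit_event.
- move=> X /= h; exists k.+1; split.
  + by move=> i ik; rewrite h ?(ltnW ik)// => -[+ _]; apply; apply: yC.
  + by rewrite h.
  + move=> i /andP[i0]; rewrite leq_eqVlt => /predU1P[->|ik].
      rewrite h// => yk1; case: yk => -[+ _] _; apply; rewrite yk1 -y0.
      exact: yC.
    by rewrite h ?(ltnW ik)//; apply: yx; rewrite i0.
rewrite (_ : mkset _ = cylinder (mkseq y k.+2)).
  exact: measurable_cylinder.
apply/seteqP; split => X /= h i; rewrite ?size_mkseq => ik.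
  by rewrite nth_mkseq//; exact: h.
by rewrite h ?size_mkseq// nth_mkseq.
Qed.

End quenched.

(** * Geometry of the hypercube *)

Section cube.
Variables (n : nat) (e : 'I_n.+1 -> dir n).
Hypothesis e_orth :
  forall i j, dotp (uvec (e i)) (uvec (e j)) = (i == j)%:R :> int.
Implicit Types (v : vertex n) (x : lattice n) (i j : 'I_n.+1).

Lemma doppK : involutive (@Defs.dopp n).
Proof. by case=> a b; rewrite /Defs.dopp/= negbK. Qed.

Lemma uvec_dopp (u : dir n) : uvec (Defs.dopp u) = - uvec u.
Proof. by case: u => a b; rewrite /uvec/= signrN scaleNr. Qed.

Lemma adj_uvec x (u : dir n) : adj (x + uvec u) x.
Proof.
rewrite /adj addrC addKr (bigD1 u.1)//= big1 => [|i iu]; last first.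
  by rewrite /uvec !mxE (negbTE iu) andbF mulr0 normr0.
by rewrite /uvec !mxE !eqxx mulr1 normrX normrN1 expr1n addr0.
Qed.

Lemma adj_sym x y : adj x y -> adj y x.
Proof.
rewrite /adj => xy; rewrite -[RHS]xy; apply: eq_bigr => i _.
by rewrite -opprB mxE normrN.
Qed.

(** The direction of axis [i] that leaves the hypercube at the vertex [v]. *)
Definition outward v i : dir n := if v i then e i else Defs.dopp (e i).
Definition inward v i : dir n := Defs.dopp (outward v i).
Definition flip v i : vertex n := [ffun k => v k (+) (k == i)].

Lemma flipK i : involutive (flip^~ i).
Proof. by move=> v; apply/ffunP => k; rewrite !ffunE -addbA addbb addbF. Qed.

Lemma flip_same v i : flip v i i = ~~ v i.
Proof. by rewrite ffunE eqxx addbT. Qed.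

Lemma flip_other v i k : k != i -> flip v i k = v k.
Proof. by move=> /negbTE ki; rewrite ffunE ki addbF. Qed.

Lemma outward_flip v i : outward (flip v i) i = inward v i.
Proof.
by rewrite /inward /outward flip_same; case: (v i) => //=; rewrite doppK.
Qed.

Lemma outward_flip_other v i k : k != i -> outward (flip v i) k = outward v k.
Proof. by move=> ki; rewrite /outward flip_other. Qed.

Let coord i x := dotp x (uvec (e i)).

Let coordD i x y : coord i (x + y) = coord i x + coord i y.
Proof.
by rewrite /coord /dotp -big_split; apply: eq_bigr => k _; rewrite mxE mulrDl.
Qed.

Let coordN i x : coord i (- x) = - coord i x.
Proof.
by rewrite /coord /dotp -sumrN; apply: eq_bigr => k _; rewrite mxE mulNr.
Qed.

Let coord_corner i v : coord i (corner e v) = (v i)%:R.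
Proof.
have -> : coord i (corner e v) = \sum_(k | v k) coord i (uvec (e k)).
  rewrite /coord /dotp exchange_big/=; apply: eq_bigr => l _.
  by rewrite /corner summxE mulr_suml.
rewrite (eq_bigr (fun k => (k == i)%:R)) => [|k _]; last exact: e_orth.
rewrite big_mkcond (bigD1 i)//= eqxx big1 ?addr0; first by case: (v i).
by move=> k /negbTE ->; case: (v k).
Qed.

Let coord_e i k : coord i (uvec (e k)) = (k == i)%:R.
Proof. exact: e_orth. Qed.

Let coord_outward i v : coord i (uvec (outward v i)) = if v i then 1 else -1.
Proof.
by rewrite /outward; case: (v i); rewrite ?uvec_dopp ?coordN coord_e eqxx.
Qed.

Lemma corner_flip v i : corner e (flip v i) = corner e v + uvec (inward v i).
Proof.
rewrite /corner [LHS]big_mkcond [in RHS]big_mkcond (bigD1 i)//=.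
rewrite [in RHS](bigD1 i)//= flip_same /inward /outward.
rewrite (eq_bigr (fun k => if v k then uvec (e k) else 0)) => [|k ki].
  by case: (v i) => /=; rewrite ?doppK ?uvec_dopp ?add0r ?addr0 1?addrC ?addrK.
by rewrite flip_other.
Qed.

Lemma corner_inj : injective (corner e).
Proof.
move=> v1 v2 h; apply/ffunP => i.
have := coord_corner i v1; rewrite h coord_corner.
by case: (v1 i); case: (v2 i).
Qed.

Lemma outward_notin_cube x v i :
  ~ hypercube e x (x + corner e v + uvec (outward v i)).
Proof.
move=> [v' _]; rewrite -addrA => /addrI /(congr1 (coord i)).
rewrite coordD !coord_corner coord_outward.
by case: (v i); case: (v' i).
Qed.

Lemma corner_in_cube x v : hypercube e x (x + corner e v).
Proof. by exists v. Qed.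

Lemma outward_bdry_at x v i :
  bdry_at (hypercube e x) (x + corner e v) (x + corner e v + uvec (outward v i)).
Proof.
split; last exact/adj_sym/adj_uvec.
split; first exact: outward_notin_cube.
by exists (x + corner e v); [exact: corner_in_cube|exact: adj_uvec].
Qed.

(* Two basis vectors on the same axis would have scalar product 1 or -1. *)
Let axis_inj : injective (fun i => (e i).1).
Proof.
move=> i k h; apply/eqP; apply/negP => ik.
have := e_orth i k; rewrite (negPf (introT negP ik)).
rewrite /dotp (bigD1 (e i).1)//= big1 => [|l li].
  by rewrite /uvec !mxE h !eqxx; case: (e i).2; case: (e k).2.
by rewrite /uvec !mxE (negbTE li) andbF mulr0 mul0r.
Qed.

Lemma big_dirE (V : nmodType) (g : dir n -> V) v :
  \sum_u g u = \sum_i (g (outward v i) + g (inward v i)).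
Proof.
transitivity (\sum_a \sum_b g (a, b)).
  by rewrite pair_bigA; apply: eq_bigr => -[].
rewrite (reindex_inj axis_inj)/=; apply: eq_bigr => i _.
rewrite big_bool/= /inward /outward.
by case: (v i); case: (e i) => a []; rewrite ?doppK /= ?/Defs.dopp/= // addrC.
Qed.

Lemma outward_neq_inward v i j : outward v i != inward v j.
Proof.
have [->|ij] := eqVneq i j.
  by rewrite /inward; case: (outward v j) => a b; apply/eqP => -[]; case: b.
apply/eqP => /(congr1 fst); rewrite /inward /outward => h.
by move/eqP: ij; apply; apply: axis_inj; move: h; case: (v i); case: (v j).
Qed.

Lemma inward_inj v : injective (inward v).
Proof.
move=> i j /(congr1 fst); rewrite /inward /outward => h.
by apply: axis_inj; move: h; case: (v i); case: (v j).
Qed.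

Lemma big_dir_neq_inward (V : nmodType) (g : dir n -> V) v j :
  \sum_(u | u != inward v j) g u =
  \sum_i (g (outward v i) + (if i == j then 0 else g (inward v i))).
Proof.
rewrite big_mkcond (big_dirE _ v); apply: eq_bigr => i _.
by rewrite outward_neq_inward (inj_eq (@inward_inj v)); case: eqP.
Qed.

(** Opposite vertices of the hypercube already exhaust the directions: the
inward directions are the [e i] at one and their opposites at the other. *)
Lemma inward_surj (u : dir n) : exists v j, inward v j = u.
Proof.
have [f fK Kf] := injF_bij axis_inj.
have [h|h] := eqVneq (e (f u.1)).2 u.2.
  exists [ffun=> false], (f u.1); rewrite /inward /outward ffunE doppK.
  by rewrite [LHS]surjective_pairing h Kf; case: (u).
exists [ffun=> true], (f u.1); rewrite /inward /outward ffunE /Defs.dopp.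
rewrite Kf; case: (u) h => a b /=.
by case: (e _).2; case: b.
Qed.

End cube.

(** * Straight exits from an edge of the hypercube *)

Section tube.
Variables (R : realType) (n : nat) (e : 'I_n.+1 -> dir n).
Hypothesis e_orth :
  forall i j, dotp (uvec (e i)) (uvec (e j)) = (i == j)%:R :> int.
Variables (v0 : vertex n) (j : 'I_n.+1).
Implicit Types (v : vertex n) (i : 'I_n.+1) (w : env R n).

Local Notation outward := (outward e).
Local Notation inward := (inward e).
Local Notation C := (hypercube e (- corner e v0)).

(** The hypercube is placed so that its vertex [v0] is the origin. *)
Definition site (v : vertex n) : lattice n := - corner e v0 + corner e v.

Lemma site_root : site v0 = 0.
Proof. exact: addNr. Qed.

Lemma site_inj : injective site.
Proof. by move=> v1 v2 /addrI; exact: (corner_inj e_orth). Qed.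

Lemma site_flip v i : site (flip v i) = site v + uvec (inward v i).
Proof. by rewrite /site corner_flip addrA. Qed.

(** The version of [Qtilde_ge_path] for a path that crosses the axes [ds] and
then leaves the hypercube along the axis [i]. *)
Lemma Qtilde_ge_vertex_path w (vs : nat -> vertex n) (ds : nat -> 'I_n.+1) k i :
  vs 0%N = v0 ->
  (forall m, (m < k)%N -> vs m.+1 = flip (vs m) (ds m)) ->
  (forall m, (0 < m <= k)%N -> vs m != v0) ->
  (\prod_(m < k) w (site (vs m)) (inward (vs m) (ds m))) *
    w (site (vs k)) (outward (vs k) i) <= Qtilde w C 0 (site (vs k)).
Proof.
move=> vs0 vsS vsn0.
pose y m := if (m <= k)%N then site (vs m)
  else site (vs k) + uvec (outward (vs k) i).
pose u m := if (m < k)%N then inward (vs m) (ds m) else outward (vs k) i.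
have yE m : (m <= k)%N -> y m = site (vs m) by rewrite /y => ->.
have := @Qtilde_ge_path R n w C 0 y u k; rewrite (yE 0%N)// (yE k)// big_ord_recr/=.
rewrite (yE k)// /u ltnn.
have -> : \prod_(m < k) w (y m) (if (m < k)%N then inward (vs m) (ds m)
    else outward (vs k) i) = \prod_(m < k) w (site (vs m)) (inward (vs m) (ds m)).
  by apply: eq_bigr => m _; rewrite yE ?(ltnW (ltn_ord m))// ltn_ord.
apply.
- by rewrite vs0 site_root.
- move=> m mk; rewrite (yE m)//; move: mk; rewrite leq_eqVlt => /predU1P[->|mk].
    by rewrite /y !ltnn.
  by rewrite yE// mk vsS// site_flip.
- by move=> m mk; rewrite yE//; exact: corner_in_cube.
- move=> m /andP[m0 mk]; rewrite yE// -site_root => /site_inj/eqP.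
  by apply/negP; apply: vsn0; rewrite m0.
- by rewrite /y ltnn; exact: outward_bdry_at.
Qed.

(** The pairs (v, i) for which the line through v in direction i meets the edge
    {v0, flip v0 j}. *)
Definition tube v i := [forall k, (k != j) ==> (k != i) ==> (v k == v0 k)].

Lemma tubeP v i :
  reflect (forall k, k != j -> k != i -> v k = v0 k) (tube v i).
Proof.
apply: (iffP forallP) => h k.
  by move=> kj ki; have := h k; rewrite kj ki => /eqP.
by apply/implyP => kj; apply/implyP => ki; rewrite h.
Qed.

Lemma tube_flip v i : tube (flip v i) i = tube v i.
Proof.
apply/tubeP/tubeP => h k kj ki; have := h k kj ki; by rewrite flip_other.
Qed.

(** Either [v] lies on the edge, or it is the far end of a line of direction
[i] through one of the two ends of the edge. *)
Lemma tube_cases v i : tube v i ->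
  [\/ v = v0, v = flip v0 j |
      i != j /\ (v = flip v0 i \/ v = flip (flip v0 j) i)].
Proof.
move=> /tubeP h.
have eqf v' k : v k != v' k -> v k = ~~ v' k by case: (v k); case: (v' k).
have [ij|ij] := eqVneq i j.
  have [vj|/eqf vj] := eqVneq (v j) (v0 j).
    apply: Or31; apply/ffunP => k; have [->//|kj] := eqVneq k j.
    by apply: h; rewrite ?ij.
  apply: Or32; apply/ffunP => k; have [->|kj] := eqVneq k j.
    by rewrite flip_same.
  by rewrite flip_other//; apply: h; rewrite ?ij.
have [vi|/eqf vi] := eqVneq (v i) (v0 i); have [vj|/eqf vj] := eqVneq (v j) (v0 j).
- apply: Or31; apply/ffunP => k; have [->//|kj] := eqVneq k j.
  by have [->//|ki] := eqVneq k i; apply: h.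
- apply: Or32; apply/ffunP => k; have [->|kj] := eqVneq k j.
    by rewrite flip_same.
  by rewrite flip_other//; have [->//|ki] := eqVneq k i; apply: h.
- apply: Or33; split => //; left; apply/ffunP => k.
  have [->|ki] := eqVneq k i; first by rewrite flip_same.
  by rewrite flip_other//; have [->//|kj] := eqVneq k j; apply: h.
- apply: Or33; split => //; right; apply/ffunP => k.
  have [->|ki] := eqVneq k i; first by rewrite flip_same flip_other.
  rewrite flip_other//; have [->//|kj] := eqVneq k j; first by rewrite flip_same.
  by rewrite flip_other//; apply: h.
Qed.

Lemma flip_neq v i : flip v i != v.
Proof.
by apply/eqP => /ffunP/(_ i); rewrite flip_same; case: (v i).
Qed.

(** The path runs from 0 to the point of the edge on the line of direction
[i] through [v], then straight out.  The step along the edge and the step inside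
the line may be absent; bounding their probabilities by 1 gives one formula for
all cases.  For [i = j] the line is the edge itself. *)
Lemma Qtilde_ge_tube w v i : tube v i ->
  w 0 (inward v0 j) * (if i == j then 1 else w (site (flip v i)) (outward v i)) *
    w (site v) (outward v i) <= Qtilde w C 0 (site v).
Proof.
set b := (if _ then _ else _).
have [b0 b1] : 0 <= b /\ b <= 1.
  by rewrite /b; case: ifP => // _; rewrite jump_ge0 jump_le1.
have p0 := jump_ge0 (w 0) (inward v0 j); have p1 := jump_le1 (w 0) (inward v0 j).
have q0 := jump_ge0 (w (site v)) (outward v i).
move=> /tube_cases[vE|vE|[ij vE]].
- have := @Qtilde_ge_vertex_path w (fun=> v0) (fun=> j) 0 i erefl.
  rewrite big_ord0 mul1r -vE => h; apply: le_trans (h _ _) => //; last by case.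
  rewrite ler_piMl ?jump_ge0//.
  by rewrite mulr_ile1 ?jump_ge0 ?jump_le1.
- have := @Qtilde_ge_vertex_path w (nth v0 [:: v0; v]) (fun=> j) 1 i erefl.
  rewrite big_ord1/= site_root => h; apply: le_trans (h _ _).
  + by rewrite ler_wpM2r// ler_piMr.
  + by case.
  + by case=> [|[]]// _; rewrite /= vE flip_neq.
- rewrite /b (negbTE ij); case: vE => vE.
    have := @Qtilde_ge_vertex_path w (nth v0 [:: v0; v]) (fun=> i) 1 i erefl.
    rewrite big_ord1/= vE flipK outward_flip => h; apply: le_trans (h _ _).
    + by rewrite ler_wpM2r ?jump_ge0// ler_piMl ?jump_ge0.
    + by case.
    + by case=> [|[]]// _; rewrite /= flip_neq.
  have := @Qtilde_ge_vertex_path w (nth v0 [:: v0; flip v0 j; v])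
    (nth j [:: j; i]) 2 i erefl.
  rewrite big_ord_recr big_ord1/= vE flipK outward_flip site_root.
  apply; first by case=> [|[]].
  case=> [|[|[]]]// _ /=; first by rewrite flip_neq.
  apply/eqP => /ffunP/(_ i); rewrite flip_same flip_other//.
  by case: (v0 i).
Qed.

(** A line of direction [i] has two ends, and their outward directions are
opposite.  One line of direction [j] meets the edge (it contains it), and two
lines of each other direction do. *)
Lemma sum_tube_ge (phi : dir n -> R) : (forall u, 0 <= phi u) ->
  2 * (\sum_u phi u) - (phi (inward v0 j) + phi (outward v0 j)) <=
  \sum_v \sum_(i | tube v i) phi (outward v i).
Proof.
move=> phi0; rewrite (exchange_big_dep xpredT)//= (big_dirE e_orth phi v0).
pose Phi i := phi (outward v0 i) + phi (inward v0 i).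
have -> : 2 * (\sum_i Phi i) - (phi (inward v0 j) + phi (outward v0 j)) =
    \sum_i (if i == j then Phi i else 2 * Phi i).
  rewrite (bigD1 j)//= [in RHS](bigD1 j)//= eqxx mulrDr mulr_sumr.
  rewrite [in RHS](eq_bigr (fun i => 2 * Phi i)) => [|i /negbTE ->//].
  by rewrite /Phi; ring.
apply: ler_sum => i _.
have sub (s : seq (vertex n)) : uniq s -> all (tube^~ i) s ->
    \sum_(v <- s) phi (outward v i) <= \sum_(v | tube v i) phi (outward v i).
  move=> us /allP ts; rewrite big_uniq//= [leRHS](bigID (mem s))/=.
  rewrite (eq_bigl (fun v => tube v i && (v \in s))); last first.
    by move=> v; apply/idP/andP => [vs|[]//]; split; [exact: ts|].
  by rewrite lerDl sumr_ge0.
have t0 : tube v0 i by apply/tubeP.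
have tj : tube (flip v0 j) i by apply/tubeP => k kj _; rewrite flip_other.
case: ifPn => [/eqP ij|ij].
  apply: le_trans (sub [:: v0; flip v0 j] _ _).
  - by rewrite !big_cons big_nil addr0 ij outward_flip.
  - by rewrite /= inE eq_sym flip_neq.
  - by rewrite /= t0 tj.
apply: le_trans (sub [:: v0; flip v0 i; flip v0 j; flip (flip v0 j) i] _ _).
- rewrite !big_cons big_nil !outward_flip /inward !outward_flip_other//.
  by rewrite -/(inward v0 i) /Phi; lra.
- pose g v := (v i (+) v0 i, v j (+) v0 j).
  have fij v : flip v i j = v j by rewrite flip_other// eq_sym.
  have fji v : flip v j i = v i by rewrite flip_other.
  apply: (@map_uniq _ _ g); rewrite /= /g !flip_same !fij !fji !flip_same.
  by case: (v0 i); case: (v0 j).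
- by rewrite /= !tube_flip t0 tj.
Qed.

End tube.

(** * Negative moments in terms of the jump probabilities *)

Section cost.
Variables (R : realType) (n : nat) (phi : dir n -> R).
Hypothesis phi0 : forall u, 0 <= phi u.

Definition cost (u : dir n) (p : simplex R n) : R :=
  expR (\sum_(u' | u' != u) phi u' * ln (p u')^-1).

Lemma cost_ge0 u p : 0 <= cost u p.
Proof. exact: expR_ge0. Qed.

Lemma measurable_cost u : measurable_fun setT (cost u).
Proof.
rewrite (_ : cost u = fun p => expR (\sum_(u' <- [seq u' <- index_enum _ | u' != u])
    phi u' * ln (p u')^-1)); last first.
  by apply/funext => p; rewrite big_filter.
apply: measurableT_comp => //; apply: measurable_sum => u'.
apply: measurable_funM => //.
have -> : (fun p : simplex R n => ln (p u')^-1) = (fun p => - ln (p u')).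
  apply/funext => p; have := jump_ge0 p u'; rewrite le_eqVlt => /predU1P[<-|p0].
    by rewrite invr0 ln0// oppr0.
  by rewrite lnV.
apply: measurable_funN.
by apply: measurableT_comp; [exact: measurable_ln|exact: measurable_jump].
Qed.

Lemma powRN_le_expR (Q a b : R) : 0 < Q -> a * ln Q^-1 <= b ->
  Q `^ (- a) <= expR b.
Proof.
by move=> Q0 h; rewrite /powR gt_eqF// ler_expR mulNr -mulrN -lnV//.
Qed.

Variable e : 'I_n.+1 -> dir n.
Hypothesis e_orth :
  forall i j, dotp (uvec (e i)) (uvec (e j)) = (i == j)%:R :> int.
Variable w : env R n.
Hypothesis w0 : forall x u, 0 < w x u.

Local Notation outward := (outward e).
Local Notation inward := (inward e).

Let loss x u : R := phi u * ln (w x u)^-1.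

Let lnV_ge0 x u : 0 <= ln (w x u)^-1.
Proof. by rewrite ln_ge0// invf_ge1// jump_le1. Qed.

Let loss_ge0 x u : 0 <= loss x u.
Proof. by rewrite mulr_ge0. Qed.

(** The maximum is at least each of the outward probabilities, and the direction
missing from [cost] is an inward one. *)
Lemma powRN_Qmax_le v i0 :
  Qmax w (hypercube e 0) (corner e v) `^ (- \sum_i phi (outward v i)) <=
  cost (inward v i0) (w (corner e v)).
Proof.
have Qge i : w (corner e v) (outward v i) <= Qmax w (hypercube e 0) (corner e v).
  rewrite /Qmax; apply: (le_bigmax_cond _ (fun u => w (corner e v) u)).
  by rewrite mem_set//; have := outward_bdry_at e_orth 0 v i; rewrite add0r.
have Q0 : 0 < Qmax w (hypercube e 0) (corner e v).
  exact: lt_le_trans (w0 _ _) (Qge ord0).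
apply: powRN_le_expR => //; rewrite (big_dir_neq_inward e_orth) mulr_suml.
apply: ler_sum => i _; rewrite -[leLHS]addr0 lerD//.
  rewrite ler_wpM2l// ler_ln ?posrE ?invr_gt0//.
  by rewrite lef_pV2 ?posrE.
by case: ifP => // _; exact: loss_ge0.
Qed.

Variables (v0 : vertex n) (j : 'I_n.+1).
Local Notation site := (site e v0).
Local Notation tube := (tube v0 j).

Lemma lnV_Qtilde_le (c : R) v i : 0 < c <= w 0 (inward v0 j) -> tube v i ->
  0 < Qtilde w (hypercube e (- corner e v0)) 0 (site v) /\
  ln (Qtilde w (hypercube e (- corner e v0)) 0 (site v))^-1 <=
  ln c^-1 + (if i == j then 0 else ln (w (site (flip v i)) (outward v i))^-1) +
  ln (w (site v) (outward v i))^-1.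
Proof.
move=> /andP[c0 cw] tvi.
have := Qtilde_ge_tube e_orth w tvi; set Q := Qtilde _ _ _ _.
set b := (if _ then _ else _) => hQ.
have b0 : 0 < b by rewrite /b; case: ifP.
have -> : (if i == j then 0 else ln (w (site (flip v i)) (outward v i))^-1)
    = ln b^-1.
  by rewrite /b; case: ifP => // _; rewrite invr1 ln1.
have h : c * b * w (site v) (outward v i) <= Q.
  by apply: le_trans hQ; rewrite !ler_wpM2r// ltW.
have cbw : 0 < c * b * w (site v) (outward v i) by rewrite !mulr_gt0.
have Q0 : 0 < Q by exact: lt_le_trans h.
split => //; rewrite -!lnM ?posrE ?mulr_gt0 ?invr_gt0// -!invfM.
by rewrite ler_ln ?posrE ?invr_gt0// lef_pV2 ?posrE.
Qed.

(** The crossing of the line through [v] in direction [i] happens at the site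
[flip v i] along its inward direction of axis [i]; after the substitution of
[flip v i] for [v], the exponents found at a site are those of all outward
directions and of the inward directions of axes other than [j]. *)
Lemma prod_powRN_Qtilde_le (c : R) : 0 < c <= w 0 (inward v0 j) ->
  \prod_v Qtilde w (hypercube e (- corner e v0)) 0 (site v)
    `^ (- \sum_(i | tube v i) phi (outward v i)) <=
  expR (\sum_v \sum_i phi (outward v i) * ln c^-1) *
  \prod_v cost (inward v j) (w (site v)).
Proof.
move=> cw; have /andP[c0 cw1] := cw.
have c1 : 0 <= ln c^-1.
  by rewrite ln_ge0// invf_ge1// (le_trans cw1)// jump_le1.
rewrite -expR_sum -expRD.
pose B v i := phi (outward v i) * ln c^-1 +
  (if i == j then 0 else loss (site (flip v i)) (outward v i)) +
  loss (site v) (outward v i).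
have B0 v i : 0 <= B v i.
  by rewrite !addr_ge0 ?mulr_ge0//; case: ifP.
apply: (@le_trans _ _ (\prod_v expR (\sum_i B v i))).
  apply: ler_prod => v _; rewrite powR_ge0/=.
  (* At a vertex with exponent 0 no lower bound on Qtilde is available. *)
  have [i tvi|notube] := pickP (tube v); last first.
    by rewrite big_pred0// oppr0 powRr0 -expR0 ler_expR sumr_ge0.
  have [Q0 _] := lnV_Qtilde_le cw tvi.
  apply: powRN_le_expR => //; rewrite mulr_suml [leRHS](bigID (tube v))/=.
  rewrite -[leLHS]addr0 lerD ?sumr_ge0//; apply: ler_sum => k tvk.
  apply: (@le_trans _ _ (phi (outward v k) * (ln c^-1 +
    (if k == j then 0 else ln (w (site (flip v k)) (outward v k))^-1) +
     ln (w (site v) (outward v k))^-1))).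
    by rewrite ler_wpM2l//; have [] := lnV_Qtilde_le cw tvk.
  by rewrite /B !mulrDr; case: ifP; rewrite ?mulr0.
rewrite -expR_sum ler_expR.
under eq_bigr do rewrite /B big_split/= big_split/= -addrA.
rewrite big_split/= lerD2l.
have -> : \sum_v (\sum_i (if i == j then 0
      else loss (site (flip v i)) (outward v i)) +
      \sum_i loss (site v) (outward v i)) =
    \sum_v \sum_(u | u != inward v j) loss (site v) u.
  rewrite [RHS](eq_bigr (fun v => \sum_i (if i == j then 0
      else loss (site v) (inward v i)) +
      \sum_i loss (site v) (outward v i))); last first.
    by move=> v _; rewrite (big_dir_neq_inward e_orth) big_split/= addrC.
  rewrite !big_split/=; congr (_ + _).
  rewrite exchange_big [RHS]exchange_big/=; apply: eq_bigr => i _.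
  rewrite (reindex_inj (can_inj (flipK i)))/=; apply: eq_bigr => v _.
  by rewrite flipK (outward_flip e).
by [].
Qed.

End cost.

(** * Markovian discovery *)

Section discovery.
Variables (n : nat) (v0 : vertex n).
Implicit Types (v : vertex n).

Definition hamming v : nat := #|[pred i | v i != v0 i]|.

(** Sorting by distance to [v0] makes every vertex but the first a neighbour of
an earlier one. *)
Definition vertex_order : seq (vertex n) :=
  sort (relpre hamming leq) (enum {: vertex n}).

Lemma vertex_order_uniq : uniq vertex_order.
Proof. by rewrite sort_uniq enum_uniq. Qed.

Lemma size_vertex_order : size vertex_order = (2 ^ n.+1)%N.
Proof. by rewrite size_sort -cardT card_ffun card_bool card_ord. Qed.

Lemma mem_vertex_order v : v \in vertex_order.
Proof. by rewrite mem_sort mem_enum. Qed.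

Lemma index_vertex_order_lt v v' : (hamming v < hamming v')%N ->
  (index v vertex_order < index v' vertex_order)%N.
Proof.
move=> vv'; rewrite ltnNge; apply/negP => le_idx.
have tr : transitive (relpre hamming leq) by move=> ? ? ?; exact: leq_trans.
have srt : sorted (relpre hamming leq) vertex_order.
  by apply: sort_sorted => x y; exact: leq_total.
have := sorted_leq_nth tr (fun x => leqnn _) v0 srt.
move=> /(_ (index v' vertex_order) (index v vertex_order)).
rewrite !inE !index_mem !mem_vertex_order => /(_ isT isT le_idx).
by rewrite /= !nth_index ?mem_vertex_order// leqNgt vv'.
Qed.

Lemma hamming_flip v i : v i != v0 i -> (hamming (flip v i) < hamming v)%N.
Proof.
move=> vi; apply: proper_card; apply/properP; split.
  apply/fintype.subsetP => k; rewrite !inE; have [->|ki] := eqVneq k i.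
    by rewrite vi.
  by rewrite flip_other.
exists i; rewrite !inE ?vi// flip_same negbK.
by move: vi; case: (v i); case: (v0 i).
Qed.

Lemma neq_root v : v != v0 -> exists i, v i != v0 i.
Proof.
move=> vv0; apply/existsP; apply: contraNT vv0 => /existsPn h.
by apply/eqP/ffunP => i; apply/eqP; have := h i; rewrite negbK.
Qed.

Lemma nth_vertex_order0 : nth v0 vertex_order 0 = v0.
Proof.
have s0 : (0 < size vertex_order)%N by rewrite size_vertex_order expn_gt0.
apply/eqP; apply: contraT => /neq_root[i /hamming_flip].
by move=> /index_vertex_order_lt; rewrite index_uniq// vertex_order_uniq.
Qed.

Lemma nth_vertex_orderS k : (k.+1 < 2 ^ n.+1)%N -> exists m i,
  (m <= k)%N /\ nth v0 vertex_order k.+1 = flip (nth v0 vertex_order m) i.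
Proof.
rewrite -size_vertex_order => ks; set v := nth _ _ k.+1.
have /neq_root[i vi] : v != v0.
  rewrite /v -[X in _ != X]nth_vertex_order0.
  by rewrite nth_uniq ?vertex_order_uniq// (leq_ltn_trans _ ks).
exists (index (flip v i) vertex_order), i; split.
  have := index_vertex_order_lt (hamming_flip vi).
  by rewrite [X in (_ < X)%N]index_uniq ?vertex_order_uniq.
by rewrite nth_index ?mem_vertex_order// flipK.
Qed.

End discovery.

Section markovian.
Variables (R : realType) (n : nat) (e : 'I_n.+1 -> dir n).
Hypothesis e_orth :
  forall i j, dotp (uvec (e i)) (uvec (e j)) = (i == j)%:R :> int.

(** The origin is always among the explored sites, so the events of its jump
probabilities are observable. *)
Lemma sigma_at_origin (S : env R n -> set (lattice n)) (B : set (simplex R n)) :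
  (forall w, S w 0) -> measurable B -> sigma_at S [set w : env R n | B (w 0)].
Proof.
move=> S0 mB; apply: sub_gen_smallest; exists 0, B => //.
by apply/seteqP; split => w //= [].
Qed.

Variables (P : probability (env R n) R) (r : simplex R n -> vertex n).
Hypothesis mr : forall A : set (vertex n), measurable [set p | A (r p)].

(** Once the position of the hypercube is known from the site 0, nothing more has
to be learnt from the environment to enumerate its vertices. *)
Lemma markovian_rooted_cube :
  markovian_hypercube e P (fun w => hypercube e (- corner e (r (w 0)))).
Proof.
pose f k (w : env R n) :=
  site e (r (w 0)) (nth (r (w 0)) (vertex_order (r (w 0))) k).
have h0 w : hypercubes0 e (hypercube e (- corner e (r (w 0)))).
  split; last by exists (- corner e (r (w 0))).
  by rewrite -(site_root e (r (w 0))); exact: corner_in_cube.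
have f0 w : f 0%N w = 0 by rewrite /f nth_vertex_order0 site_root.
have disc0 i w : discovered f i w 0 by exists 0%N.
have disc_sub i w : discovered f i w `<=` hypercube e (- corner e (r (w 0))).
  by move=> _ [k _ <-]; exact: corner_in_cube.
split => //; exists f; split => //.
- move=> w; apply/seteqP; split => // _ [v _ <-].
  exists (index v (vertex_order (r (w 0)))); last first.
    by rewrite /f nth_index// mem_vertex_order.
  rewrite /= -ltnS prednK ?expn_gt0// -(size_vertex_order (r (w 0))).
  by rewrite index_mem mem_vertex_order.
- move=> i _ Y; apply: (sigma_at_origin (disc0 i)
    (B := [set p | [set v | Y (site e v (nth v (vertex_order v) i.+1))] (r p)])).
  exact: mr.
- move=> i ilt w; set v0 := r (w 0); have ilt' := ilt.
  rewrite -(size_vertex_order v0) in ilt'; split.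
    move=> [k /= ki] /(site_inj e_orth)/eqP; rewrite nth_uniq ?vertex_order_uniq//.
      by rewrite ltn_eqF.
    exact: leq_ltn_trans (leqW ki) ilt'.
  have [m [a [mi vE]]] := nth_vertex_orderS v0 ilt.
  exists (f m w); first by exists m.
  by rewrite /f -/v0 vE site_flip; exact: adj_uvec.
- by move=> i _; apply: aeW => w; exists (hypercube e (- corner e (r (w 0)))).
Qed.

End markovian.

(** * A direction of large probability *)

Section likely.
Variables (R : realType) (n : nat).

(** The mean of the jump probabilities, which some direction must reach. *)
Definition likely_mass : R := #|{: dir n}|%:R^-1.

Definition likely_dir (p : simplex R n) : dir n :=
  let b := [ffun u => likely_mass <= p u] in odflt (ord0, false) [pick u | b u].

Lemma likely_mass_gt0 : 0 < likely_mass.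
Proof.
rewrite invr_gt0 ltr0n; apply/card_gt0P; by exists (ord0, false).
Qed.

Lemma likely_dir_ge (p : simplex R n) : likely_mass <= p (likely_dir p).
Proof.
rewrite /likely_dir; case: pickP => [u /=|h /=]; first by rewrite ffunE.
have /andP[_ /eqP s1] := jumpP p.
have : \sum_u p u < \sum_(u : dir n) likely_mass.
  apply: ltr_sum; first by apply/hasP; exists (ord0, false).
  by move=> u _; rewrite ltNge; have := h u; rewrite ffunE => ->.
rewrite s1 sumr_const -[X in _ < X]mulr_natr mulVf ?ltxx//.
by rewrite -invr_eq0 gt_eqF// likely_mass_gt0.
Qed.

(** The choice depends only on which directions pass the threshold, so there are
finitely many cases. *)
Lemma measurable_likely_dir (A : set (dir n)) :
  measurable [set p : simplex R n | A (likely_dir p)].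
Proof.
rewrite (_ : mkset _ = \bigcup_(b : {ffun dir n -> bool})
    (if `[< A (odflt (ord0, false) [pick u | b u]) >]
     then [set p : simplex R n | forall u, (likely_mass <= p u) = b u]
     else set0)); last first.
  apply/seteqP; split => p /=.
    move=> Ap; exists [ffun u => likely_mass <= p u] => //.
    by rewrite asboolT// => u; rewrite ffunE.
  move=> [b _]; case: asboolP => // Ab pb; rewrite /likely_dir.
  by rewrite (_ : [ffun u => _] = b)//; apply/ffunP => u; rewrite ffunE.
apply: countable_bigcupT_measurable => [//|b]; case: asboolP => // _.
rewrite (_ : mkset _ = \bigcap_(u in [set: dir n])
    [set p : simplex R n | (likely_mass <= p u) = b u]); last first.
  by apply/seteqP; split => [p h u _|p h u]; exact: h.
apply: fin_bigcap_measurable => [//|u _].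
have mle : measurable_fun setT (fun p : simplex R n => likely_mass <= p u).
  by apply: measurable_fun_ler => //; exact: measurable_jump.
by have := mle measurableT [set b u]; rewrite setTI; apply.
Qed.

End likely.

(** * The theorem *)

Section product.
Variables (R : realType) (n : nat) (P : probability (env R n) R).
Hypothesis iidP : iid_env P.
Local Open Scope ereal_scope.

Lemma iid_expectation_prod_lty (I : finType) (x : I -> lattice n)
    (F : I -> simplex R n -> R) : injective x ->
  (forall i, measurable_fun setT (F i)) -> (forall i p, (0 <= F i p)%R) ->
  (forall i, \int[P]_w (F i (w 0%R))%:E < +oo) ->
  \int[P]_w (\prod_i F i (w (x i)))%:E < +oo.
Proof.
move=> x_inj mF F0 Foo.
(* The functions are indexed by I, not by sites; x is inverted on its image. *)
pose G y p : R := if [pick i | x i == y] is Some i then F i p else 0%R.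
have GE i p : G (x i) p = F i p.
  by rewrite /G; case: pickP => [k /eqP/x_inj ->//|/(_ i)]; rewrite eqxx.
have mG y : measurable_fun setT (G y) by rewrite /G; case: pickP.
have G0 y p : (0 <= G y p)%R by rewrite /G; case: pickP.
have Goo y : \int[P]_w (G y (w y))%:E < +oo.
  rewrite (@iid_expectation_site R n P iidP (G y) y)// /G.
  by case: pickP => // _; rewrite integral0 ltry.
have := @iid_expectation_prod R n P iidP G (map x (enum I)) mG G0 Goo.
rewrite map_inj_uniq// enum_uniq => /(_ isT) h.
rewrite (_ : (fun w : env R n => _) =
  fun w : env R n => (\prod_(y <- map x (enum I)) G y (w y))%:E); last first.
  apply/funext => w; congr _%:E; rewrite big_map big_enum/=.
  by apply: eq_bigr => i _; rewrite GE.
rewrite h -ge0_fin_numE; last first.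
  by apply: prode_ge0 => y _; apply: integral_ge0 => w _; rewrite lee_fin.
apply: prode_fin_num => y _; rewrite ge0_fin_numE//.
by apply: integral_ge0 => w _; rewrite lee_fin.
Qed.

End product.

Theorem proposition4p2 (R : realType) (n : nat)
    (ell : 'rV[R]_n.+1) (e : 'I_n.+1 -> dir n)
    (P : probability (env R n) R) :
  (2 <= n.+1)%N ->
  dotp ell ell = 1 ->
  adapted_basis ell e ->
  iid_env P ->
  elliptic P ->
  condE' P ->
  condK e P.
Proof.
move=> _ _ [e_orth _ _] iidP ellP [phi [phi_gt0 phi_sup phi_int]].
have phi0 u : 0 <= phi u by exact/ltW.
have /choice[ra raE] : forall u, exists va : vertex n * 'I_n.+1,
    inward e va.1 va.2 = u.
  by move=> u; have [v [a va]] := inward_surj e_orth u; exists (v, a).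
pose root u := (ra u).1; pose axis u := (ra u).2.
have rootE u : inward e (root u) (axis u) = u by exact: raE.
pose dir0 (w : env R n) := likely_dir (w 0).
pose weight u v := \sum_(i | tube (root u) (axis u) v i) phi (outward e v i).
have weight_ge0 u v : 0 <= weight u v by exact: sumr_ge0.
have cost_lty u x : (\int[P]_w (cost phi u (w x))%:E < +oo)%E.
  rewrite (@iid_expectation_site R n P iidP (cost phi u) x); last 2 first.
  - exact: measurable_cost.
  - exact: cost_ge0.
  by have := phi_int u; rewrite expectation.unlock.
exists (fun v => \sum_i phi (outward e v i)).
exists (fun w => hypercube e (- corner e (root (dir0 w)))).
exists (fun w => - corner e (root (dir0 w))).
exists (fun v w => weight (dir0 w) v); split.
- move=> v; split; first exact: sumr_ge0.
  rewrite expectation.unlock; apply: (ae_le_integral_lty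
    (mu := P)
    (g := fun w : env R n => (cost phi (inward e v ord0) (w (corner e v)))%:E));
    last exact: cost_lty.
  + by move=> w; rewrite lee_fin powR_ge0.
  + by move=> w; rewrite lee_fin cost_ge0.
  + apply/measurable_EFinP; apply: measurableT_comp.
      exact: measurable_cost.
    exact: measurable_site.
  + by apply: filterS ellP => w w0; rewrite lee_fin; exact: powRN_Qmax_le.
- split.
  + apply: (@markovian_rooted_cube R n e e_orth P
      (fun p => root (likely_dir p))) => A.
    exact: (measurable_likely_dir [set u | A (root u)]).
  + by move=> v w; exact: weight_ge0.
  + move=> v B _.
    apply: (sigma_at_origin (B := [set p | [set u | B (weight u v)]
      (likely_dir p)])).
      by move=> w; rewrite -(site_root e (root (dir0 w))); exact: corner_in_cube.
    exact: measurable_likely_dir.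
- by [].
- (* The chosen direction is one of finitely many: the bound for it is at most
     the sum of the bounds over all directions. *)
  pose K := expR (\sum_v \sum_i phi (outward e v i) * ln (likely_mass R n)^-1).
  pose g u (w : env R n) :=
    \prod_v cost phi (inward e v (axis u)) (w (site e (root u) v)).
  have g_ge0 u w : 0 <= g u w by apply: prodr_ge0 => v _; exact: cost_ge0.
  have mg u : measurable_fun setT (g u).
    apply: measurable_prod => v _; apply: measurableT_comp.
      exact: measurable_cost.
    exact: measurable_site.
  have mKg u : measurable_fun setT (fun w => (K * g u w)%:E).
    by apply/measurable_EFinP; exact: measurable_funM.
  have Kg_ge0 u w : (0 <= (K * g u w)%:E)%E.
    by rewrite lee_fin mulr_ge0// expR_ge0.
  rewrite expectation.unlock; apply: (ae_le_integral_lty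
    (mu := P) (g := fun w : env R n => (\sum_u (K * g u w)%:E)%E)).
  + by move=> w; rewrite lee_fin; apply: prodr_ge0 => v _; exact: powR_ge0.
  + by move=> w; exact: sume_ge0.
  + exact: emeasurable_sum.
  + apply: filterS ellP => w w0; rewrite (bigD1 (dir0 w))//=.
    apply: (@le_trans _ _ (K * g (dir0 w) w)%:E); last first.
      by rewrite leeDl// sume_ge0.
    rewrite lee_fin; apply: prod_powRN_Qtilde_le => //.
    by rewrite likely_mass_gt0 rootE likely_dir_ge.
  + rewrite ge0_integral_sum//; apply: lte_sum_pinfty => u _.
    rewrite (_ : (fun w => _) = fun w => (K%:E * (g u w)%:E)%E)//.
    rewrite ge0_integralZl_EFin ?expR_ge0//.
    * rewrite lte_mul_pinfty ?lee_fin ?expR_ge0//.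
      apply: (iid_expectation_prod_lty iidP (x := site e (root u))
        (F := fun v => cost phi (inward e v (axis u)))).
      - exact: site_inj.
      - by move=> v; exact: measurable_cost.
      - by move=> v p; exact: cost_ge0.
      - by move=> v; exact: cost_lty.
    * by move=> w _; rewrite lee_fin.
    * exact/measurable_EFinP.
- exists (2 * (\sum_u phi u) - sup (range
    (fun u => phi u + phi (Defs.dopp u))) - 1).
    by rewrite subr_gt0.
  apply: aeW => w; rewrite addrC subrK.
  rewrite (eq_bigr (weight (dir0 w))); last first.
    move=> v _; apply/min_idPr.
    by rewrite [leRHS](bigID (tube (root (dir0 w)) (axis (dir0 w)) v))/= lerDl
      sumr_ge0.
  apply: le_trans (sum_tube_ge e_orth (root (dir0 w)) (axis (dir0 w)) phi0).
  rewrite lerD2l lerN2; apply: ub_le_sup.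
    exists (\sum_u phi u + \sum_u phi u) => _ [u _ <-].
    have le_sum u' : phi u' <= \sum_u phi u by rewrite (bigD1 u')//= lerDl sumr_ge0.
    exact: lerD.
  exists (inward e (root (dir0 w)) (axis (dir0 w))) => //.
  by rewrite /inward (@doppK n).
Qed.
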